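(* Consider a stochastic $K$-armed bandit ($K\ge 2$) whose arm reward distributions $\nu_1,\dots,\nu_K$ are supported on $[0,1]$, with means ordered $\mu_1\ge\mu_2\ge\cdots\ge\mu_K$, run with the KL-MS algorithm for $T$ rounds. Then for any $\Delta\ge 0$ and any $c\in(0,\tfrac14]$, \[ \mathrm{Reg}(T)\le T\Delta+\sum_{a:\Delta_a>\Delta}\frac{\Delta_a\ln\big(T\,\mathsf{kl}(\mu_a+c\Delta_a,\mu_1-c\Delta_a)\vee e^2\big)}{\mathsf{kl}(\mu_a+c\Delta_a,\mu_1-c\Delta_a)} +392\sum_{a:\Delta_a>\Delta}\Big(\frac{\dot\mu_1+\Delta_a}{c^2\Delta_a}\Big)\ln\Big(\Big(\frac{\dot\mu_1+\Delta_a}{c^2\Delta_a^2}\wedge\frac{c^2T\Delta_a^2}{\dot\mu_1+\Delta_a}\Big)\vee e^2\Big). \]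
   Context: Bandit model: arm $i\in[K]=\{1,\dots,K\}$ has reward distribution $\nu_i$ supported on $[0,1]$ with mean $\mu_i$; arms are indexed so that $\mu_1\ge\cdots\ge\mu_K$ (arm 1 is optimal). At each round $t=1,\dots,T$ the learner chooses $I_t\in[K]$ and observes reward $y_t\sim\nu_{I_t}$, drawn independently of the past given $I_t$. $N_{t,a}=\sum_{s\le t}\mathbf 1\{I_s=a\}$; $\hat\mu_{t,a}=\frac{1}{N_{t,a}}\sum_{s\le t}\mathbf 1\{I_s=a\}y_s$; $\hat\mu_{t,\max}=\max_{a}\hat\mu_{t,a}$. $\Delta_a=\mu_1-\mu_a$. Pseudo-regret $\mathrm{Reg}(T)=T\mu_1-\mathbb E\sum_{t=1}^T y_t=\sum_a\Delta_a\mathbb E[N_{T,a}]$. Binary KL divergence $\mathsf{kl}(p,q)=p\ln\frac pq+(1-p)\ln\frac{1-p}{1-q}$ for $p,q\in[0,1]$ (with $0\ln 0=0$). For $\mu\in[0,1]$, $\dot\mu=\mu(1-\mu)$; in particular $\dot\mu_1=\mu_1(1-\mu_1)$. $x\vee y=\max(x,y)$, $x\wedge y=\min(x,y)$. KL-MS algorithm: for $t\le K$ pull arm $I_t=t$; for $t\ge K+1$, sample $I_t$ from the distribution $p_{t,a}=\exp\big(-N_{t-1,a}\,\mathsf{kl}(\hat\mu_{t-1,a},\hat\mu_{t-1,\max})\big)/M_t$, where $M_t=\sum_{b=1}^K\exp\big(-N_{t-1,b}\,\mathsf{kl}(\hat\mu_{t-1,b},\hat\mu_{t-1,\max})\big)$.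 *)

(* Defs.v *)
From HB Require Import structures.
From mathcomp Require Import all_boot all_order all_algebra.
From mathcomp Require Import all_classical all_reals all_analysis.
Set Implicit Arguments. Unset Strict Implicit. Unset Printing Implicit Defensive.
Import Order.TTheory GRing.Theory Num.Theory.
Local Open Scope ring_scope.

Section KLMS.
Variable R : realType.

(* Binary KL divergence kl(p,q) on [0,1], extended-real valued, with the
   convention 0 ln 0 = 0 (ln 0 = 0 in MathComp, so p*ln(p/q) = 0 when p = 0)
   and kl(p,q) = +oo when q in {0,1} and p <> q. *)
Definition kl (p q : R) : \bar R :=
  if p == q then 0%E
  else if (q <= 0) || (1 <= q) then +oo%E
  else (p * ln (p / q) + (1 - p) * ln ((1 - p) / (1 - q)))%:E.

Variable K : nat.

Definition history := seq ('I_K * R).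

Definition Ncount (h : history) (a : 'I_K) : nat :=
  count (fun p : 'I_K * R => p.1 == a) h.

Definition muhat (h : history) (a : 'I_K) : R :=
  (\sum_(p <- h | p.1 == a) p.2) / (Ncount h a)%:R.

(* \hat mu_{t,max}; the seed a0 is itself one of the maximized values, so
   the result does not depend on a0. *)
Definition muhat_max (h : history) (a0 : 'I_K) : R :=
  \big[Num.max/muhat h a0]_(b < K) muhat h b.

Definition klms_weight (h : history) (a : 'I_K) : R :=
  match kl (muhat h a) (muhat_max h a) with
  | EFin r => expR (- ((Ncount h a)%:R * r))
  | _ => 0
  end.

(* Sampling distribution of KL-MS at round t = size h + 1 given history h:
   rounds t <= K pull arm t (0-based index t-1 = size h). *)
Definition klms_prob (h : history) (a : 'I_K) : R :=
  if (size h < K)%N then (if nat_of_ord a == size h then 1 else 0)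
  else klms_weight h a / \sum_(b < K) klms_weight h b.

Variable nu : 'I_K -> probability R R.

(* Expectation of f(history after n further rounds), starting from h, under
   KL-MS interacting with the bandit nu (finite-horizon Ionescu-Tulcea
   construction by backward induction). *)
Fixpoint klms_expect (n : nat) (h : history) (f : history -> R) : R :=
  match n with
  | 0 => f h
  | n'.+1 => \sum_(a < K) klms_prob h a *
       Rintegral (nu a) setT (fun y => klms_expect n' (rcons h (a, y)) f)
  end.

Definition mean (a : 'I_K) : R := Rintegral (nu a) setT (fun y => y).

Definition klms_regret (a1 : 'I_K) (T : nat) : R :=
  T%:R * mean a1 - klms_expect T [::] (fun h => \sum_(p <- h) p.2).

End KLMS.

(* Main.v *)
Require Import Defs.
From HB Require Import structures.
From mathcomp Require Import all_boot all_order all_algebra.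
From mathcomp Require Import all_classical all_reals all_analysis.
From mathcomp Require Import measurable_realfun ring lra.
Import Order.TTheory GRing.Theory Num.Theory.
Set Implicit Arguments. Unset Strict Implicit. Unset Printing Implicit Defensive.
Local Open Scope ring_scope.

(* Fix a suboptimal arm [a] of gap [D], and put [e = c D], [z = mu_a + e],
   [x = mu_1 - e], [v = mu_1 (1 - mu_1)], [H = (v + D) / e^2].  Given a history,
   the probability of pulling [a] is controlled in four cases:
   - [a] has been pulled fewer than [u = ln (T kl(z, x) \/ e^2) / kl(z, x)]
     times, which happens at most [u + 1] times;
   - otherwise, if muhat_a <= z and muhat_max >= x, this probability is at most
     exp(- u kl(z, x)) <= 1 / (T kl(z, x));
   - muhat_a > z, which Chernoff's bound with a variance term allows for at
     most 5 H pulls of [a] on average;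
   - muhat_max < x, where the probability of [a] is at most
     exp(N_1 kl(muhat_1, x)) times the probability of arm 1, so that the
     expected number of pulls is at most
     sum_k E[exp(k kl(muhat_(k), x)); muhat_(k) < x], with muhat_(k) the
     average of the first [k] rewards of arm 1.
   With x' = mu_1 - e / 2, kl(p, x) <= kl(p, x') - kl(x, x') for p <= x, and
   exp(k kl(p, x')) is at most a constant times a sum of likelihood ratios
   (q/x')^(k p) ((1-q)/(1-x'))^(k (1-p)) over O(sqrt k) values of [q] equally
   spaced in sqrt q.  The mean of each ratio at muhat_(k) decays geometrically
   in k (x' - q), so that the k-th expectation is at most
   C exp(- k / (16 H)) (1 + sqrt (H / k)), which sums to O(H): the minimum
   inside the last logarithm is not even needed.

   All these expectations are tracked by explicit potential functions, bounded
   on [0, 1] by affine functions of the next reward.  Hence only affine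
   functions are ever integrated, and measurability of [klms_expect] in the
   rewards never has to be proved. *)

(** * Binary divergence: Pythagorean inequality and quadratic lower bound *)

Section BinaryKL.
Variable R : realType.
Implicit Types p q z x y t a b : R.

Lemma ln_le_sub1 x : 0 < x -> ln x <= x - 1.
Proof.
by move=> x0; have := @le_ln1Dx R (x - 1); rewrite [1 + _]addrC subrK; apply; lra.
Qed.

Definition KL p q := p * ln (p / q) + (1 - p) * ln ((1 - p) / (1 - q)).

(** The log-likelihood ratio of Bernoulli parameters [z] and [q], averaged under parameter [p];
    being affine in [p], it also serves for single rewards in [0, 1]. *)
Definition tilt p z q := p * ln (z / q) + (1 - p) * ln ((1 - z) / (1 - q)).

Lemma klE p q : 0 < q < 1 -> kl p q = (KL p q)%:E.
Proof.
move=> /andP[q0 q1]; rewrite /kl; case: eqP => [->|_].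
  by rewrite /KL !divff ?ln1 ?mulr0 ?addr0 //; lra.
by rewrite leNgt q0 leNgt q1.
Qed.

Lemma mul_ln_div_split p z q : 0 <= p -> 0 < z -> 0 < q ->
  p * ln (p / q) = p * ln (p / z) + p * ln (z / q).
Proof.
rewrite le_eqVlt => /predU1P[<-|p0] z0 q0; first by rewrite !mul0r addr0.
by rewrite !ln_div ?posrE//; ring.
Qed.

Lemma KL_tilt p z q : 0 <= p <= 1 -> 0 < z < 1 -> 0 < q < 1 ->
  KL p q = KL p z + tilt p z q.
Proof.
move=> /andP[p0 p1] /andP[z0 z1] /andP[q0 q1]; rewrite /KL /tilt.
rewrite (@mul_ln_div_split p z q)// (@mul_ln_div_split (1 - p) (1 - z) (1 - q)); lra.
Qed.

Lemma mul_ln_div_ge p q : 0 <= p -> 0 < q -> p - q <= p * ln (p / q).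
Proof.
rewrite le_eqVlt => /predU1P[<-|p0] q0; first by rewrite mul0r; lra.
have := @ln_le_sub1 (q / p) (divr_gt0 q0 p0).
rewrite -(ler_pM2l p0) mulrBr mulr1 mulrCA divff ?gt_eqF// mulr1 !ln_div ?posrE//.
by rewrite !mulrBr; lra.
Qed.

Lemma mul_ln_div_le p q : 0 <= p -> 0 < q -> p * ln (p / q) <= p * (p / q - 1).
Proof.
rewrite le_eqVlt => /predU1P[<-|p0] q0; first by rewrite !mul0r.
by rewrite ler_pM2l// ln_le_sub1// divr_gt0.
Qed.

Lemma KL_ge0 p q : 0 <= p <= 1 -> 0 < q < 1 -> 0 <= KL p q.
Proof.
move=> /andP[p0 p1] /andP[q0 q1]; rewrite /KL.
have h1 := mul_ln_div_ge p0 q0.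
have h2 : 1 - p - (1 - q) <= (1 - p) * ln ((1 - p) / (1 - q)).
  by apply: mul_ln_div_ge; lra.
lra.
Qed.

Lemma KL_le_chi2 p q : 0 <= p <= 1 -> 0 < q < 1 ->
  KL p q <= (p - q) ^+ 2 / (q * (1 - q)).
Proof.
move=> /andP[p0 p1] /andP[q0 q1]; rewrite /KL.
have h1 := mul_ln_div_le p0 q0.
have h2 : (1 - p) * ln ((1 - p) / (1 - q)) <= (1 - p) * ((1 - p) / (1 - q) - 1).
  by apply: mul_ln_div_le; lra.
apply: le_trans (lerD h1 h2) _; rewrite le_eqVlt; apply/orP; left; apply/eqP.
by field; apply/andP; split; lra.
Qed.

Lemma tilt_monol p p' z q : p <= p' -> 0 < z -> z <= q -> q < 1 ->
  tilt p' z q <= tilt p z q.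
Proof.
move=> pp z0 zq q1; rewrite /tilt.
have h1 : ln (z / q) <= 0.
  by rewrite ln_le0// ler_pdivrMr ?mul1r//; lra.
have h2 : 0 <= ln ((1 - z) / (1 - q)).
  by rewrite ln_ge0// ler_pdivlMr ?mul1r//; lra.
by nra.
Qed.

Lemma tilt_diag z q : tilt z z q = KL z q.
Proof. by []. Qed.

(** [tilt p z q] is affine in [p] and nonincreasing when [z <= q], so at [p <= z] it is at least its
    value at [z], which is [KL z q]. *)
Lemma KL_pyth p z q : 0 <= p -> p <= z -> 0 < z -> z <= q -> q < 1 ->
  KL p z + KL z q <= KL p q.
Proof.
move=> p0 pz z0 zq q1; rewrite (@KL_tilt p z q); try by apply/andP; split; lra.
by rewrite lerD2l -tilt_diag tilt_monol.
Qed.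

Lemma KL_mono p z x q : 0 <= p -> p <= z -> 0 < z -> z <= x -> x <= q -> q < 1 ->
  KL z x <= KL p q.
Proof.
move=> p0 pz z0 zx xq q1.
have h1 := KL_pyth p0 (le_trans pz zx) (lt_le_trans z0 zx) xq q1.
have h2 := KL_pyth p0 pz z0 zx (le_lt_trans xq q1).
have h3 : 0 <= KL p z by apply: KL_ge0; apply/andP; split; lra.
have h4 : 0 <= KL x q by apply: KL_ge0; apply/andP; split; lra.
lra.
Qed.

Lemma expR_le_quad t : `|t| <= 1/2 -> expR t <= 1 + t + t ^+ 2.
Proof.
rewrite ler_norml => /andP[t1 t2].
(* Cubing the tangent bound at [t / 3] is sharp enough; the plain [1 - t] would only give the
   product [1 - t ^+ 3]. *)
have h : 1 + - (t / 3) <= expR (- (t / 3)) by exact: expR_ge1Dx.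
have h3 : (1 - t / 3) ^+ 3 <= expR (- t).
  have -> : - t = 3%:R * (- (t / 3)) by field.
  by rewrite expRM_natl lerXn2r ?nnegrE ?expR_ge0//; lra.
have e0 := expR_gt0 (- t); have := expRxMexpNx_1 t => ee.
have e1 := expR_gt0 t.
have h4 : 1 <= (1 + t + t ^+ 2) * (1 - t / 3) ^+ 3.
  have -> : (1 + t + t ^+ 2) * (1 - t / 3) ^+ 3 =
    1 + t ^+ 2 * (9 - 19 * t + 8 * t ^+ 2 - t ^+ 3) / 27 by field.
  have : 0 <= 9 - 19 * t + 8 * t ^+ 2 - t ^+ 3 by nra.
  have : 0 <= t ^+ 2 by exact: sqr_ge0.
  by nra.
have q0 : 0 < 1 + t + t ^+ 2 by nra.
rewrite -(ler_pM2r e0) ee; apply: le_trans h4 _; rewrite ler_pM2l//.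
Qed.

Lemma expR_convex y a b : 0 <= y <= 1 ->
  expR (y * a + (1 - y) * b) <= y * expR a + (1 - y) * expR b.
Proof.
move=> /andP[y0 y1]; set m := y * a + (1 - y) * b.
have h u : expR m * (1 + (u - m)) <= expR u.
  have -> : expR u = expR m * expR (u - m) by rewrite -expRD addrC subrK.
  by rewrite ler_pM2l ?expR_gt0 ?expR_ge1Dx.
have := h a; have := h b.
have e0 := expR_gt0 m.
move=> hb ha.
have -> : expR m = y * (expR m * (1 + (a - m))) + (1 - y) * (expR m * (1 + (b - m))).
  by rewrite /m; ring.
by apply: lerD; apply: ler_wpM2l => //; lra.
Qed.

(** A Bernstein-type bound. Comparing with the tilted parameter [z] and dropping [KL p z] leaves
    [l * d - ln Z], where [Z] is the centred Laplace transform, at [- l], of a Bernoulli law of mean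
    [q]. *)
Lemma KL_ge_quad p q : 0 <= p -> p <= q -> 0 < q < 1 ->
  (q - p) ^+ 2 / (4 * (q * (1 - q) + (q - p))) <= KL p q.
Proof.
move=> p0 pq /andP[q0 q1].
set v := q * (1 - q); set d := q - p.
have v0 : 0 < v by rewrite /v; nra.
have d0 : 0 <= d by rewrite /d; lra.
pose l := d / (2 * (v + d)).
have l0 : 0 <= l by rewrite /l divr_ge0//; lra.
have l1 : l <= 1/2 by rewrite /l ler_pdivrMr; lra.
pose Z := q * expR (- (l * (1 - q))) + (1 - q) * expR (l * q).
have eq1 := expR_gt0 (- (l * (1 - q))); have eq2 := expR_gt0 (l * q).
have A0 : 0 < q * expR (- (l * (1 - q))) by rewrite mulr_gt0.
have B0 : 0 < (1 - q) * expR (l * q) by rewrite mulr_gt0//; lra.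
have Z0 : 0 < Z by rewrite /Z; lra.
pose z := q * expR (- (l * (1 - q))) / Z.
have zE : 1 - z = (1 - q) * expR (l * q) / Z.
  by rewrite /z /Z; field; rewrite gt_eqF.
have z01 : 0 < z < 1.
  by rewrite divr_gt0//= -subr_gt0 zE divr_gt0.
have ZB : Z <= 1 + l ^+ 2 * v.
  have h1 : expR (- (l * (1 - q))) <= 1 + - (l * (1 - q)) + (- (l * (1 - q))) ^+ 2.
    by apply: expR_le_quad; rewrite normrN ger0_norm; nra.
  have h2 : expR (l * q) <= 1 + l * q + (l * q) ^+ 2.
    by apply: expR_le_quad; rewrite ger0_norm; nra.
  have -> : 1 + l ^+ 2 * v = q * (1 + - (l * (1 - q)) + (- (l * (1 - q))) ^+ 2) +
     (1 - q) * (1 + l * q + (l * q) ^+ 2) by rewrite /v; ring.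
  by rewrite /Z; apply: lerD; apply: ler_wpM2l => //; lra.
have lnZ : ln Z <= l ^+ 2 * v by have := ln_le_sub1 Z0; lra.
have p01 : 0 <= p <= 1 by apply/andP; split; lra.
have q01 : 0 < q < 1 by apply/andP; split.
rewrite (KL_tilt p01 z01 q01).
have tE : tilt p z q = l * d - ln Z.
  rewrite /tilt zE /z.
  have -> : q * expR (- (l * (1 - q))) / Z / q = expR (- (l * (1 - q))) / Z.
    by field; rewrite !gt_eqF.
  have -> : (1 - q) * expR (l * q) / Z / (1 - q) = expR (l * q) / Z.
    by field; rewrite !gt_eqF//; lra.
  by rewrite !ln_div ?posrE// !expRK /d; ring.
have K0 := KL_ge0 p01 z01.
rewrite tE.
have -> : d ^+ 2 / (4 * (v + d)) = l * d - l ^+ 2 * (v + d).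
  by rewrite /l; field; rewrite gt_eqF//; lra.
have : 0 <= l ^+ 2 * d by rewrite mulr_ge0 ?sqr_ge0.
nra.
Qed.
End BinaryKL.

(** * Sums of exponentials, and mixtures of likelihood ratios over a grid *)

Section ExponentialSums.
Variable R : realType.
Implicit Types p q z x y t a b e : R.

Lemma sum_expR_le b n : 0 < b -> \sum_(1 <= i < n) expR (- (b * i%:R)) <= b^-1.
Proof.
move=> b0; case: n => [|n]; first by rewrite big_geq// invr_ge0 ltW.
(* The right side is the integral of [expR (- (b * t))] over [[0, n]], a form that the induction can
   carry. *)
suff : \sum_(1 <= i < n.+1) expR (- (b * i%:R)) <= (1 - expR (- (b * n%:R))) / b.
  by move=> /le_trans; apply; rewrite ler_pdivrMr// mulVf ?gt_eqF// gerBl expR_ge0.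
elim: n => [|n IH]; first by rewrite big_geq// mulr0 oppr0 expR0 subrr mul0r.
rewrite big_nat_recr//=.
apply: le_trans (lerD IH (lexx _)) _.
rewrite ler_pdivlMr// mulrDl mulfVK ?gt_eqF//.
have -> : expR (- (b * n%:R)) = expR (- (b * n.+1%:R)) * expR b.
  by rewrite -expRD -natr1; congr expR; ring.
have := expR_ge1Dx b; have := expR_gt0 (- (b * n.+1%:R)); nra.
Qed.

(** Only indices up to [a^-1] contribute, each at most twice the increment of the square root. The
    minimum keeps both facts in one induction. *)
Lemma sum_sqrt_inv_le a n : 0 < a ->
  \sum_(1 <= k < n.+1) (if a * k%:R <= 1 then (Num.sqrt k%:R)^-1 else 0)
    <= 2 * Num.min (Num.sqrt n%:R) (Num.sqrt a)^-1.
Proof.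
move=> a0; have sa0 : 0 < Num.sqrt a by rewrite sqrtr_gt0.
elim: n => [|n IH].
  by rewrite big_geq// mulr_ge0// le_min sqrtr_ge0 invr_ge0 ltW.
rewrite big_nat_recr//=.
have mono : Num.sqrt n%:R <= Num.sqrt n.+1%:R :> R by rewrite ler_sqrt ?ler_nat.
have s0 : 0 < Num.sqrt n.+1%:R :> R by rewrite sqrtr_gt0.
case: ifP => [an|_]; last first.
  rewrite addr0; apply: le_trans IH _; rewrite ler_pM2l//.
  by rewrite le_min !ge_min mono lexx orbT.
have -> : Num.min (Num.sqrt n.+1%:R) (Num.sqrt a)^-1 = Num.sqrt n.+1%:R.
  apply/min_idPl; rewrite -(ler_pM2l sa0) divff ?gt_eqF// -(sqrtrM _ (ltW a0)).
  by rewrite -[leRHS](@sqrtr1 R) ler_sqrt.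
have le1 : Num.min (Num.sqrt n%:R) (Num.sqrt a)^-1 <= Num.sqrt n%:R by rewrite ge_min lexx.
suff : (Num.sqrt n.+1%:R)^-1 <= 2 * (Num.sqrt n.+1%:R - Num.sqrt n%:R) :> R by lra.
set r := Num.sqrt n.+1%:R; set r' := Num.sqrt n%:R.
have r2 : r ^+ 2 = r' ^+ 2 + 1 by rewrite !sqr_sqrtr// natr1.
have r'0 : 0 <= r' by rewrite sqrtr_ge0.
rewrite -(ler_pM2l s0) divff ?gt_eqF// -/r; nra.
Qed.

(** Split at [a * k = 1]: before it the exponential is at most 1 and the inverse roots sum to at
    most [2 / sqrt a]; after it the inverse root is at most [sqrt a] and the exponentials sum to at
    most [a^-1]. *)
Lemma sum_expR_sqrt_le a n : 0 < a ->
  \sum_(1 <= k < n) expR (- (a * k%:R)) / Num.sqrt k%:R <= 3 / Num.sqrt a.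
Proof.
move=> a0; have sa0 : 0 < Num.sqrt a by rewrite sqrtr_gt0.
case: n => [|n]; first by rewrite big_geq// divr_ge0 ?sqrtr_ge0.
have h1 := @sum_sqrt_inv_le a n a0.
have h2 : \sum_(1 <= i < n.+1) Num.sqrt a * expR (- (a * i%:R)) <= (Num.sqrt a)^-1.
  rewrite -mulr_sumr; apply: le_trans (ler_wpM2l (ltW sa0) (sum_expR_le n.+1 a0)) _.
  by rewrite -{2}(sqr_sqrtr (ltW a0)) expr2 invfM mulrA divff ?gt_eqF// mul1r.
have h3 : Num.min (Num.sqrt n%:R) (Num.sqrt a)^-1 <= (Num.sqrt a)^-1.
  by rewrite ge_min lexx orbT.
suff : \sum_(1 <= k < n.+1) expR (- (a * k%:R)) / Num.sqrt k%:R <=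
   \sum_(1 <= k < n.+1) (if a * k%:R <= 1 then (Num.sqrt k%:R)^-1 else 0) +
   \sum_(1 <= i < n.+1) Num.sqrt a * expR (- (a * i%:R)) by lra.
rewrite -big_split/= big_nat_cond [leRHS]big_nat_cond.
apply: ler_sum => k /andP[/andP[k0 _] _].
have k0' : 0 < k%:R :> R by rewrite ltr0n.
have s0 : 0 < Num.sqrt k%:R :> R by rewrite sqrtr_gt0.
have e0 := expR_gt0 (- (a * k%:R)).
case: ifPn => [_|].
  apply: ler_wpDr; first by rewrite mulr_ge0// ltW.
  rewrite ler_pdivrMr// mulVf ?gt_eqF// -[leRHS]expR0 ler_expR oppr_le0.
  by rewrite mulr_ge0// ltW.
rewrite -ltNge => ak; rewrite add0r mulrC ler_pM2r//.
rewrite -(ler_pM2l s0) divff ?gt_eqF// -sqrtrM// -[leLHS](@sqrtr1 R) mulrC ler_sqrt ?mulr_gt0//.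
  exact: ltW.
by rewrite mulr_ge0 ?ltW.
Qed.

(* The grid is uniform in the square root of the parameter, where the Fisher
   information of a Bernoulli variable is bounded near 0. *)
Definition grid x n (i : nat) := x * (1 - i%:R / n%:R) ^+ 2.

Lemma grid_cover t m : 0 <= t -> t <= m.+1%:R ->
  exists2 i, (i < m.+1)%N & i%:R <= t <= i%:R + 1.
Proof.
elim: m => [|m IH] t0 tm.
  by exists 0%N => //; rewrite t0 add0r.
have [tm'|tm'] := leP t m.+1%:R.
  by have [i im hi] := IH t0 tm'; exists i => //; exact: leqW.
by exists m.+1 => //; rewrite (ltW tm')/= natr1.
Qed.

Lemma grid_gt0 x m i : 0 < x -> (i < m.+1)%N -> 0 < grid x m.+1 i.
Proof.
move=> x0 im; rewrite /grid mulr_gt0// exprn_gt0// subr_gt0 ltr_pdivrMr ?mul1r ?ltr_nat//.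
Qed.

(** From [(1 - r) ^+ 2 <= 1 - r]: the points move away from [x] at least linearly in [i], which
    later yields a geometric sum. *)
Lemma grid_le x m i : 0 < x -> (i < m.+1)%N ->
  x * (i%:R / m.+1%:R) <= x - grid x m.+1 i.
Proof.
move=> x0 im; rewrite /grid.
have : i%:R / m.+1%:R <= 1 :> R by rewrite ler_pdivrMr ?mul1r ?ler_nat ?ltr0n// ltnW.
have : 0 <= i%:R / m.+1%:R :> R by rewrite divr_ge0.
set r := i%:R / m.+1%:R => r0 r1.
have : 0 <= r * (1 - r) by rewrite mulr_ge0//; lra.
nra.
Qed.

Lemma grid_in01 x m i : 0 < x < 1 -> (i < m.+1)%N -> 0 < grid x m.+1 i < 1.
Proof.
move=> /andP[x0 x1] im; rewrite grid_gt0//=.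
have := grid_le x0 im.
have : 0 <= x * (i%:R / m.+1%:R) by rewrite mulr_ge0 ?divr_ge0// ltW.
by move: (grid _ _ _) (x * _) => g r; lra.
Qed.

(* A Laplace-type bound: every parameter has a grid point within divergence
   [k^-1], so that the grid mixture of likelihood ratios is, up to a factor
   [expR 1], as large as the maximum likelihood ratio. *)
Lemma expR_KL_le_mixture (k : nat) p x m :
  0 <= p <= x -> 0 < x < 1 -> 4 * k%:R * x <= (1 - x) * m.+1%:R ^+ 2 ->
  expR (k%:R * KL p x) <=
    \sum_(i < m.+1) expR (1 + k%:R * tilt p (grid x m.+1 i) x).
Proof.
move=> /andP[p0 px] /andP[x0 x1] hm; set N : R := m.+1%:R.
have N0 : 0 < N by rewrite ltr0n.
(* In square-root coordinates [p] sits at [w] and the grid point at [W = 1 - r]; rounding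
   [N * (1 - w)] down puts [W] above [w], within [1 / N]. *)
pose w := Num.sqrt (p / x).
have w0 : 0 <= w by exact: sqrtr_ge0.
have w2 : w ^+ 2 = p / x by rewrite sqr_sqrtr// divr_ge0// ltW.
have w1 : w <= 1.
  by rewrite -[leRHS](@sqrtr1 R) ler_sqrt// ler_pdivrMr// mul1r.
have [i im /andP[i1 i2]] : exists2 i, (i < m.+1)%N & i%:R <= N * (1 - w) <= i%:R + 1.
  by apply: grid_cover; rewrite -/N; nra.
rewrite (bigD1 (Ordinal im))//=.
apply: ler_wpDr; first by rewrite sumr_ge0// => j _; exact: expR_ge0.
rewrite ler_expR.
have p01 : 0 <= p <= 1 by apply/andP; split; lra.
have x01 : 0 < x < 1 by rewrite x0.
rewrite (KL_tilt p01 (grid_in01 x01 im) x01) mulrDr lerD2r.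
(* The difference of the two parameters factors as [x * (w - W) * (w + W)], and [w + W <= 2 * W]
   supplies the factor [W ^+ 2] of the grid point. *)
apply: le_trans (ler_wpM2l (ler0n _ k) (KL_le_chi2 p01 (grid_in01 x01 im))) _.
have /andP[q0 q1] := grid_in01 x01 im.
rewrite mulrA ler_pdivrMr ?mul1r; last by rewrite mulr_gt0//; lra.
have := grid_le x0 im.
move: q0 q1; rewrite /grid -/N; set r := i%:R / N => q0 q1 gle.
have r0 : 0 <= r by rewrite /r divr_ge0// ltW.
have iE : i%:R = N * r by rewrite /r mulrC divfK ?gt_eqF.
have pE : p = x * w ^+ 2 by rewrite w2 mulrC divfK ?gt_eqF.
pose W := 1 - r.
have Ww : w <= W by rewrite /W -(ler_pM2l N0); move: i1; rewrite iE; lra.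
have WN : N * (W - w) <= 1 by rewrite /W; move: i2; rewrite iE; lra.
rewrite -/W in q0 q1 gle *; rewrite pE.
have -> : k%:R * (x * w ^+ 2 - x * W ^+ 2) ^+ 2 =
    k%:R * x * (W + w) ^+ 2 * (W - w) ^+ 2 * x by ring.
have h1 : (W + w) ^+ 2 <= 4 * W ^+ 2 by nra.
have h2 : N ^+ 2 * (W - w) ^+ 2 <= 1.
  by rewrite -exprMn expr_le1// mulr_ge0 ?subr_ge0// ltW.
have h3 : k%:R * x * (W + w) ^+ 2 * (W - w) ^+ 2 <= W ^+ 2 * (1 - x).
  apply: (@le_trans _ _ (4 * k%:R * x * W ^+ 2 * (W - w) ^+ 2)).
    have k0 : 0 <= k%:R :> R by [].
    have d0 := sqr_ge0 (W - w).
    have : 0 <= k%:R * x * (W - w) ^+ 2.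
      by apply: mulr_ge0 => //; apply: mulr_ge0 => //; exact: ltW.
    nra.
  apply: (@le_trans _ _ ((1 - x) * N ^+ 2 * W ^+ 2 * (W - w) ^+ 2)).
    by rewrite ler_wpM2r ?sqr_ge0// ler_wpM2r ?sqr_ge0.
  have := sqr_ge0 W => WW.
  have : 0 <= W ^+ 2 * (1 - x) by rewrite mulr_ge0//; lra.
  nra.
apply: (@le_trans _ _ (W ^+ 2 * (1 - x) * x)); first by rewrite ler_wpM2r// ltW.
have : 0 <= W ^+ 2 * x by rewrite mulr_ge0 ?sqr_ge0// ltW.
have : x * W ^+ 2 <= x.
  by have : 0 <= x * r by [rewrite mulr_ge0// ltW]; lra.
nra.
Qed.

(** Convexity replaces the geometric mean of the two ratios by the arithmetic one, which is affine
    in [y]. *)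
Lemma expR_tilt_le y q x : 0 <= y <= 1 -> 0 < q < 1 -> 0 < x < 1 ->
  expR (tilt y q x) <= y * (q / x) + (1 - y) * ((1 - q) / (1 - x)).
Proof.
move=> y01 /andP[q0 q1] /andP[x0 x1].
apply: le_trans (expR_convex _ _ y01) _; rewrite !lnK//.
- by rewrite posrE divr_gt0//; lra.
- by rewrite posrE divr_gt0.
Qed.

(** When rewards have mean [x + e], the affine likelihood ratio of [q] against [x] has mean exactly
    [1 - tilt_rate q x e]. *)
Definition tilt_rate q x e := (x - q) * e / (x * (1 - x)).

Lemma sum_grid_le (l m : nat) x e : (0 < l)%N -> 0 < x < 1 -> 0 < e ->
  \sum_(i < m.+1) expR (- (l%:R * tilt_rate (grid x m.+1 i) x e))
    <= 1 + 2 * m%:R * (1 - x) / (l%:R * e).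
Proof.
move=> l0 /andP[x0 x1] e0.
have l0' : 0 < l%:R :> R by rewrite ltr0n.
have x1' : 0 < 1 - x by lra.
pose b := l%:R * e / ((1 - x) * m.+1%:R).
have b0 : 0 < b by rewrite /b !(mulr_gt0, divr_gt0, invr_gt0, ltr0n).
apply: (@le_trans _ _ (\sum_(i < m.+1) expR (- (b * i%:R)))).
  apply: ler_sum => i _; rewrite ler_expR lerN2 /tilt_rate /b.
  have := grid_le x0 (ltn_ord i); set g := grid _ _ _ => hg.
  have -> : l%:R * e / ((1 - x) * m.+1%:R) * i%:R =
    (x * (i%:R / m.+1%:R)) * (l%:R * e / (x * (1 - x))).
    by field; rewrite !gt_eqF// ltr0n.
  have -> : l%:R * ((x - g) * e / (x * (1 - x))) = (x - g) * (l%:R * e / (x * (1 - x))).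
    by field; rewrite !gt_eqF.
  by rewrite ler_wpM2r// divr_ge0// mulr_ge0// ltW.
rewrite -(big_mkord predT (fun i => expR (- (b * i%:R)))) big_ltn//.
rewrite mulr0 oppr0 expR0 lerD2l.
case: m @b b0 => [|m] b b0; first by rewrite big_geq// mulr0 !mul0r.
apply: le_trans (sum_expR_le _ b0) _.
rewrite /b invf_div; apply: ler_wpM2r.
  by rewrite invr_ge0 mulr_ge0// ltW.
rewrite mulrC; apply: ler_wpM2r; first exact: ltW.
by rewrite -natrM ler_nat mul2n doubleS !ltnS -addnn leq_addr.
Qed.

End ExponentialSums.

(** * Exponential potentials controlling deviations of the empirical means *)

Section Potentials.
Variable R : realType.
Implicit Types (mu e z x y s v w : R) (f g : R -> R).

(* [v] bounds the mean of [f] under every law on [0, 1] of mean [mu]; unlike a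
   bound on an integral, this needs no measurability of [f]. *)
Definition maj mu f v := exists B, forall y, 0 <= y <= 1 -> f y <= v + B * (y - mu).

Lemma maj_le mu f g v w : maj mu g v -> (forall y, 0 <= y <= 1 -> f y <= g y) ->
  v <= w -> maj mu f w.
Proof.
move=> [B hB] fg vw; exists B => y y01; have := hB y y01; have := fg y y01; lra.
Qed.

Lemma maj_cst mu v : maj mu (fun=> v) v.
Proof. by exists 0 => y _; rewrite mul0r addr0. Qed.

Lemma majD mu f g v w : maj mu f v -> maj mu g w -> maj mu (fun y => f y + g y) (v + w).
Proof.
move=> [B hB] [C hC]; exists (B + C) => y y01.
have := hB y y01; have := hC y y01; lra.
Qed.

Lemma majZ mu c f v : 0 <= c -> maj mu f v -> maj mu (fun y => c * f y) (c * v).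
Proof.
move=> c0 [B hB]; exists (c * B) => y y01.
by rewrite -mulrA -mulrDr ler_wpM2l// hB.
Qed.

Lemma maj_sum (I : eqType) (r : seq I) (P : pred I) mu (F : I -> R -> R) (v : I -> R) :
  (forall i, i \in r -> P i -> maj mu (F i) (v i)) ->
  maj mu (fun y => \sum_(i <- r | P i) F i y) (\sum_(i <- r | P i) v i).
Proof.
elim: r => [|i r IH] h.
  by rewrite big_nil; apply: maj_le (maj_cst mu 0) _ _ => // y _; rewrite big_nil.
have {}IH := IH (fun j jr => h j (mem_behead (s := i :: r) jr)).
rewrite big_cons; case: ifPn => Pi; last first.
  by apply: maj_le IH _ _ => // y _; rewrite big_cons (negbTE Pi).
apply: maj_le (majD (h i (mem_head _ _) Pi) IH) _ _ => // y _.
by rewrite big_cons Pi.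
Qed.

(* The [l]-th summand is a bound on the conditional expectation, given that an
   arm has been pulled [k] times with total reward [s], of
   [c l * \sum_(i < n l) expR (S * a l i + l%:R * b l i)], where [S] is the
   total reward of the arm after [l] pulls. *)
Definition expPot (n : nat -> nat) (c : nat -> R) (a b r : nat -> nat -> R)
    (T k : nat) s : R :=
  \sum_(k <= l < T | (0 < l)%N) c l *
    \sum_(i < n l) expR (s * a l i + k%:R * b l i - (l - k)%:R * r l i).

Lemma expPot_ge0 n c a b r T k s : (forall l, 0 <= c l) -> 0 <= expPot n c a b r T k s.
Proof.
move=> c0; rewrite /expPot; apply: sumr_ge0 => l _; rewrite mulr_ge0//.
by apply: sumr_ge0 => i _; exact: expR_ge0.
Qed.

(** The charge is the summand [l = k], which leaves the sum. In every other summand the new reward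
    brings a factor [expR (- r l i)], which pays for one unit of [l - k]. *)
Lemma expPot_step mu n c a b r T k s : (forall l, 0 <= c l) ->
  (forall l i, (0 < l)%N -> (i < n l)%N ->
     maj mu (fun y => expR (y * a l i + b l i)) (expR (- r l i))) ->
  (k < T)%N ->
  maj mu (fun y => expPot n c a b r T k.+1 (s + y))
    (expPot n c a b r T k s -
     if (0 < k)%N then c k * \sum_(i < n k) expR (s * a k i + k%:R * b k i) else 0).
Proof.
move=> c0 hm kT.
have -> : expPot n c a b r T k s -
     (if (0 < k)%N then c k * \sum_(i < n k) expR (s * a k i + k%:R * b k i) else 0) =
  \sum_(k.+1 <= l < T | (0 < l)%N) c l *
    \sum_(i < n l) expR (s * a l i + k%:R * b l i - (l - k)%:R * r l i).
  rewrite /expPot big_mkcond big_ltn// -big_mkcond/= subnn.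
  case: ifP => _; last by rewrite add0r subr0.
  rewrite addrAC -mulrBr -sumrB big1 ?mulr0 ?add0r// => i _.
  by rewrite mul0r subr0 subrr.
rewrite /expPot; apply: maj_sum => l; rewrite mem_index_iota => /andP[kl lT] l0.
apply: majZ => //; apply: maj_sum => i _ _.
apply: (@maj_le _ _ (fun y => expR (s * a l i + k%:R * b l i - (l - k.+1)%:R * r l i) *
   expR (y * a l i + b l i))
  (expR (s * a l i + k%:R * b l i - (l - k.+1)%:R * r l i) * expR (- r l i))).
- by apply: majZ; [exact: expR_ge0 | exact: hm].
- by move=> y _; rewrite -expRD -natr1 le_eqVlt; apply/orP; left; apply/eqP; congr expR; ring.
- rewrite -expRD le_eqVlt; apply/orP; left; apply/eqP; congr expR.
  by rewrite -(subnSK kl) -[in RHS]natr1; ring.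
Qed.

Lemma expPot0 n c a b r T : expPot n c a b r T 0 0 =
  \sum_(1 <= l < T) c l * \sum_(i < n l) expR (- (l%:R * r l i)).
Proof.
rewrite /expPot; case: T => [|T]; first by rewrite !big_geq.
rewrite big_mkcond big_ltn//= add0r; apply: eq_big_nat => l /andP[l0 _].
rewrite l0; congr (_ * _); apply: eq_bigr => i _; congr expR; rewrite subn0; ring.
Qed.

(** After the quadratic bound on [expR], [(y - mu) ^+ 2] lies below its chord on [0, 1], whose value
    at [mu] is the Bernoulli variance [mu * (1 - mu)]. *)
Lemma maj_expR_chernoff mu e l : 0 <= mu <= 1 -> 0 <= l <= 1/2 ->
  maj mu (fun y => expR (y * l - l * (mu + e)))
    (expR (- (l * e - l ^+ 2 * (mu * (1 - mu))))).
Proof.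
move=> /andP[m0 m1] /andP[l0 l1].
exists (expR (- (l * e)) * (l + l ^+ 2 * (1 - 2 * mu))) => y /andP[y0 y1].
have -> : y * l - l * (mu + e) = - (l * e) + l * (y - mu) by ring.
have -> : - (l * e - l ^+ 2 * (mu * (1 - mu))) = - (l * e) + l ^+ 2 * (mu * (1 - mu)) by ring.
rewrite !expRD -mulrA -mulrDr ler_pM2l ?expR_gt0//.
have h : expR (l * (y - mu)) <= 1 + l * (y - mu) + (l * (y - mu)) ^+ 2.
  apply: expR_le_quad; rewrite ler_norml; apply/andP; split; nra.
apply: le_trans h _.
have h2 := expR_ge1Dx (l ^+ 2 * (mu * (1 - mu))).
have : 0 <= l ^+ 2 * (y * (1 - y)) by rewrite mulr_ge0 ?sqr_ge0// mulr_ge0//; lra.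
nra.
Qed.

(** Controls the expected number of [k] for which the average of [k] rewards exceeds [mu + e], by a
    geometric sum of Chernoff bounds. *)
Lemma upper_deviation_potential mu e T : 0 <= mu <= 1 -> 0 < e ->
  exists V : nat -> R -> R, [/\ forall k s, 0 <= V k s,
    V 0%N 0 <= 4 * (mu * (1 - mu) + e) / e ^+ 2 &
    forall k s, (k < T)%N -> maj mu (fun y => V k.+1 (s + y))
      (V k s - ((0 < k)%N && (k%:R * (mu + e) < s))%:R)].
Proof.
move=> mu01 e0; have /andP[m0 m1] := mu01.
set v := mu * (1 - mu); have v0 : 0 <= v by rewrite mulr_ge0//; lra.
(* The maximizer of [l * e - l ^+ 2 * (v + e)]; the maximum is [r]. *)
pose l := e / (2 * (v + e)).
have l0 : 0 < l by rewrite divr_gt0//; lra.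
have l1 : l <= 1/2 by rewrite ler_pdivrMr; lra.
pose r := e ^+ 2 / (4 * (v + e)).
have r0 : 0 < r by rewrite divr_gt0 ?exprn_gt0//; lra.
have rl : r <= l * e - l ^+ 2 * v.
  have -> : r = l * e - l ^+ 2 * (v + e) by rewrite /r /l; field; rewrite gt_eqF//; lra.
  by have := sqr_ge0 l; nra.
have hm := @maj_expR_chernoff mu e l mu01.
exists (expPot (fun=> 1%N) (fun=> 1) (fun _ _ => l) (fun _ _ => - (l * (mu + e)))
  (fun _ _ => r) T); split.
- by move=> k s; exact: expPot_ge0.
- rewrite expPot0; apply: (@le_trans _ _ (\sum_(1 <= i < T) expR (- (r * i%:R)))).
    by apply: ler_sum => i _; rewrite big_ord1 mul1r mulrC.
  by apply: le_trans (sum_expR_le _ r0) _; rewrite /r invf_div.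
- move=> k s kT; apply: maj_le (expPot_step s _ _ kT) _ _ => //.
    move=> ? ? _ _ /=; apply: maj_le (hm _) _ _ => //; first by rewrite l1 ltW.
    by rewrite ler_expR lerN2.
  rewrite lerD2l lerN2.
  case: (0 < k)%N => //=.
  rewrite big_ord1 mul1r; case: ltP => [ks|_] /=; last exact: expR_ge0.
  apply: le_trans (expR_ge1Dx _); rewrite lerDl.
  by nra.
Qed.

Lemma maj_expR_tilt mu q x : 0 < q -> q <= x -> x < 1 ->
  maj mu (fun y => expR (y * (ln (q / x) - ln ((1 - q) / (1 - x))) + ln ((1 - q) / (1 - x))))
    (expR (- tilt_rate q x (mu - x))).
Proof.
move=> q0 qx x1.
exists (q / x - (1 - q) / (1 - x)) => y y01.
have -> : y * (ln (q / x) - ln ((1 - q) / (1 - x))) + ln ((1 - q) / (1 - x)) = tilt y q x.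
  by rewrite /tilt; ring.
have q01 : 0 < q < 1 by apply/andP; split; lra.
have x01 : 0 < x < 1 by apply/andP; split; lra.
apply: le_trans (expR_tilt_le y01 q01 x01) _.
have -> : y * (q / x) + (1 - y) * ((1 - q) / (1 - x)) =
   (1 + - tilt_rate q x (mu - x)) + (q / x - (1 - q) / (1 - x)) * (y - mu).
  by rewrite /tilt_rate; field; rewrite !gt_eqF//; lra.
by rewrite lerD2r expR_ge1Dx.
Qed.

Lemma expR1_le4 : expR 1 <= 4 :> R.
Proof.
have h : 1 + - (1/2) <= expR (- (1/2)) :> R by exact: expR_ge1Dx.
have -> : expR 1 = (expR (1/2)) ^+ 2 :> R by rewrite -expRM_natl; congr expR; field.
have := expRxMexpNx_1 (1/2 : R); have := expR_gt0 (1/2 : R); nra.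
Qed.

Lemma sum_tilt_rate_le w x e (l m : nat) : (0 < l)%N -> 0 < x < 1 -> 0 < e ->
  x * (1 - x) <= w ->
  m%:R * (1 - x) <= 2 * Num.sqrt (x * (1 - x)) * Num.sqrt l%:R ->
  \sum_(i < m.+1) expR (- (l%:R * tilt_rate (grid x m.+1 i) x (e / 2)))
    <= 1 + 8 * Num.sqrt w / e / Num.sqrt l%:R.
Proof.
move=> l0 x01 e0 xw hm.
have e20 : 0 < e / 2 by lra.
apply: le_trans (sum_grid_le _ l0 x01 e20) _; rewrite lerD2l.
have l0' : 0 < l%:R :> R by rewrite ltr0n.
set t := Num.sqrt l%:R in hm *.
have t0 : 0 < t by rewrite sqrtr_gt0.
have -> : l%:R = t ^+ 2 by rewrite sqr_sqrtr// ltW.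
have /andP[x0 x1] := x01.
have vle : Num.sqrt (x * (1 - x)) <= Num.sqrt w.
  by rewrite ler_sqrt// (le_trans _ xw)// mulr_ge0; lra.
have -> : 8 * Num.sqrt w / e / t = (4 * Num.sqrt w * t) / (t ^+ 2 * (e / 2)).
  by field; rewrite !gt_eqF.
rewrite ler_wpM2r// ?invr_ge0; first by rewrite mulr_ge0// ltW// exprn_gt0.
nra.
Qed.

Lemma lower_deviation_potential mu e w T : mu <= 1 -> 0 < e -> e < mu ->
  mu * (1 - mu) + e <= w ->
  exists W : nat -> R -> R, [/\ forall k s, 0 <= W k s,
    W 0%N 0 <= 448 * w / e ^+ 2 &
    forall k s, (k < T)%N -> 0 <= s -> maj mu (fun y => W k.+1 (s + y))
      (W k s - (if (0 < k)%N && (s < k%:R * (mu - e))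
                then expR (k%:R * KL (s / k%:R) (mu - e)) else 0))].
Proof.
move=> m1 e0 em hw.
(* In the notation of the opening summary, [z] is x and [x] is x'. One half of [e] buys the factor
   [expR (- (k * KL z x))], the other half the decay of the likelihood ratios. *)
pose z := mu - e; pose x := mu - e / 2.
have z0 : 0 < z by rewrite /z; lra.
have zx : z <= x by rewrite /z /x; lra.
have x1 : x < 1 by rewrite /x; lra.
have x01 : 0 < x < 1 by apply/andP; split=> //; lra.
have v0 : 0 < x * (1 - x) by apply: mulr_gt0; lra.
have xv : x * (1 - x) + e / 2 <= w by apply: le_trans hw; rewrite /x; nra.
have w0 : 0 < w by lra.
pose a0 := e ^+ 2 / (16 * w).
have a00 : 0 < a0 by rewrite divr_gt0 ?exprn_gt0//; lra.
have a0K : a0 <= KL z x.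
  apply: le_trans (KL_ge_quad (ltW z0) zx x01).
  have -> : x - z = e / 2 by rewrite /x /z; field.
  rewrite /a0 ler_pdivrMr; last by lra.
  rewrite mulrAC ler_pdivlMr; last by lra.
  by have := sqr_ge0 e; nra.
pose sg := Num.sqrt (x * (1 - x)).
have sg0 : 0 < sg by rewrite sqrtr_gt0.
(* Chosen so that [4 * l * x <= (1 - x) * (m l).+1 ^+ 2], as the mixture bound requires, while [m l]
   is only of order [sqrt l]. *)
pose m (l : nat) := Num.truncn (2 * sg * Num.sqrt l%:R / (1 - x)).
have mp l : 0 <= 2 * sg * Num.sqrt l%:R / (1 - x).
  by apply: divr_ge0; [rewrite !mulr_ge0 ?sqrtr_ge0// ltW | lra].
have m_le l : (m l)%:R * (1 - x) <= 2 * sg * Num.sqrt l%:R.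
  rewrite -ler_pdivlMr; last lra.
  by rewrite /m truncn_le.
have m_gt l : 2 * sg * Num.sqrt l%:R <= (1 - x) * (m l).+1%:R.
  rewrite [leRHS]mulrC -ler_pdivrMr; last lra.
  by rewrite ltW// /m truncnS_gt.
pose q l i := grid x (m l).+1 i.
(* [y * a l i + b l i] is [tilt y (q l i) x], and [c] joins the factor [expR 1] of the mixture bound
   to the Pythagorean gain. *)
pose b l i := ln ((1 - q l i) / (1 - x)).
pose a l i := ln (q l i / x) - b l i.
pose c (l : nat) := expR (1 - l%:R * KL z x).
exists (expPot (fun l => (m l).+1) c a b (fun l i => tilt_rate (q l i) x (e / 2)) T).
have c0 l : 0 <= c l by exact: expR_ge0.
split; first by move=> k s; exact: expPot_ge0.
- rewrite expPot0.
  apply: (@le_trans _ _ (\sum_(1 <= l < T) expR 1 * (expR (- (a0 * l%:R)) +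
      (8 * Num.sqrt w / e) * (expR (- (a0 * l%:R)) / Num.sqrt l%:R)))).
    rewrite big_nat [leRHS]big_nat; apply: ler_sum => l /andP[l0 _].
    have h1 : c l <= expR 1 * expR (- (a0 * l%:R)).
      rewrite -expRD ler_expR lerD2l lerN2 mulrC ler_wpM2l//.
    have h2 := @sum_tilt_rate_le w x e l (m l) l0 x01 e0.
    apply: le_trans (ler_pM (c0 l) _ h1 (h2 _ (m_le l))) _; last 2 first.
    + by lra.
    + by rewrite le_eqVlt; apply/orP; left; apply/eqP; ring.
    + by apply: sumr_ge0 => i _; exact: expR_ge0.
  rewrite -mulr_sumr big_split/= -mulr_sumr.
  have h1 := sum_expR_le T a00.
  have h2 := sum_expR_sqrt_le T a00.
  have sw0 : 0 < Num.sqrt w by rewrite sqrtr_gt0.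
  have C0 : 0 <= 8 * Num.sqrt w / e by rewrite divr_ge0 ?mulr_ge0// ltW.
  have h3 := ler_wpM2l C0 h2.
  have w2 : w = Num.sqrt w ^+ 2 by rewrite sqr_sqrtr// ltW.
  have sa : Num.sqrt a0 = e / (4 * Num.sqrt w).
    have -> : a0 = (e / (4 * Num.sqrt w)) ^+ 2.
      by rewrite /a0 {1}w2; field; rewrite gt_eqF.
    by rewrite sqrtr_sqr ger0_norm// divr_ge0 ?mulr_ge0// ltW.
  (* The two sums contribute 16 and 8 * 3 * 4 = 96; with [expR 1 <= 4] this makes 448. *)
  have h4 : a0^-1 + 8 * Num.sqrt w / e * (3 / Num.sqrt a0) = 112 * w / e ^+ 2.
    by rewrite sa /a0 {1 4}w2; field; rewrite !gt_eqF.
  have h5 := lerD h1 h3.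
  rewrite h4 in h5.
  apply: le_trans (ler_wpM2l (expR_ge0 1) h5) _.
  have we0 : 0 <= 112 * w / e ^+ 2.
    by rewrite divr_ge0 ?sqr_ge0// mulr_ge0// ltW.
  have := ler_wpM2r we0 expR1_le4.
  by rewrite !mulrA -natrM.
- move=> k s kT s0; apply: maj_le (expPot_step s c0 _ kT) _ _ => //.
    move=> l i _ il; rewrite /a /b.
    have /andP[q0 _] := @grid_in01 _ x (m l) i x01 il.
    have qx : q l i <= x.
      have := @grid_le _ x (m l) i (lt_le_trans z0 zx) il; rewrite -/(q l i).
      have : 0 <= x * (i%:R / (m l).+1%:R).
        by rewrite mulr_ge0 ?divr_ge0//; lra.
      by move: (x * _) => rr; lra.
    have := @maj_expR_tilt mu (q l i) x q0 qx x1.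
    by rewrite (_ : mu - x = e / 2)// /x; field.
  rewrite lerD2l lerN2; case: (ltnP 0 k) => //= k0; case: ifPn => [sz|_]; last first.
    by rewrite mulr_ge0// sumr_ge0// => i _; exact: expR_ge0.
  have k0' : 0 < k%:R :> R by rewrite ltr0n.
  set p := s / k%:R.
  have sE : s = k%:R * p by rewrite /p mulrC divfK ?gt_eqF.
  have p0 : 0 <= p by rewrite divr_ge0.
  have pz : p <= z by rewrite ler_pdivrMr// mulrC ltW.
  have hp : 0 <= p <= x by rewrite p0 (le_trans pz).
  have hmm : 4 * k%:R * x <= (1 - x) * (m k).+1%:R ^+ 2.
    have := m_gt k; set N := (m k).+1%:R; set t := Num.sqrt k%:R => hN.
    have t0 : 0 <= t by exact: sqrtr_ge0.
    have -> : k%:R = t ^+ 2 by rewrite sqr_sqrtr.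
    have h : (2 * sg * t) ^+ 2 <= ((1 - x) * N) ^+ 2.
      rewrite ler_sqr ?nnegrE//; last by rewrite mulr_ge0//; lra.
      by rewrite !mulr_ge0// ltW.
    rewrite -(@ler_pM2l _ (1 - x)); last lra.
    move: h; rewrite !exprMn sqr_sqrtr; last exact: ltW.
    by rewrite !expr2; lra.
  apply: (@le_trans _ _ (expR (- (k%:R * KL z x)) * expR (k%:R * KL p x))).
    rewrite -expRD ler_expR.
    have := ler_wpM2l (ler0n R k) (KL_pyth p0 pz z0 zx x1); lra.
  apply: le_trans (ler_wpM2l (expR_ge0 _) (expR_KL_le_mixture hp x01 hmm)) _.
  rewrite /c expRD [expR 1 * _]mulrC -mulrA ler_wpM2l ?expR_ge0// mulr_sumr.
  apply: ler_sum => i _; rewrite -expRD ler_expR sE /a /b /tilt -/(q k i).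
  by rewrite le_eqVlt; apply/orP; left; apply/eqP; ring.
Qed.

End Potentials.

(** * Integral bounds without measurability of the integrand *)

Section AffineIntegralBounds.
Variables (R : realType) (P : probability R R).
Hypothesis P01 : P `[0%R, 1%R]%classic = 1%E.
Local Open Scope ereal_scope.

(** The integral of a nonnegative function is a supremum over the simple functions below it, hence
    monotone for arbitrary functions; this is applied to positive and negative parts. *)
Lemma integral_le_nonmeasurable (f g : R -> \bar R) :
  (forall y, f y <= g y) -> \int[P]_y f y <= \int[P]_y g y.
Proof.
move=> fg; rewrite /integral !patch_setT; apply: leeB; apply: le_ereal_sup.
- move=> _ [h hf <-]; exists h => // y; apply: le_trans (hf y) _.
  by apply: (@funepos_le _ _ setT) => [x _|]; rewrite ?inE.
- move=> _ [h hf <-]; exists h => // y; apply: le_trans (hf y) _.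
  by apply: (@funeneg_le _ _ setT) => [x _|]; rewrite ?inE.
Qed.

(** The complement of [0, 1] is null, so any value [c] may be put there; an infinite [c] turns a
    comparison on [0, 1] into one everywhere. *)
Lemma integral_off01 (g : R -> R) (c : \bar R) : measurable_fun setT g ->
  \int[P]_y (if (0 <= y <= 1)%R then (g y)%:E else c) = \int[P]_y (g y)%:E.
Proof.
move=> mg.
have m01 : measurable_fun [set: R] (fun y : R => (0 <= y <= 1)%R).
  apply: measurable_and; first exact: measurable_fun_ler.
  exact: measurable_fun_ler.
apply: ae_eq_integral => //.
- by apply: measurable_fun_ifT => //; apply/measurable_EFinP.
- exact/measurable_EFinP.
- exists (~` `[0%R, 1%R])%classic; split.
  + exact: measurableC.
  + by apply: (eq_trans (probability_setC _ _)) => //; rewrite P01 subee.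
  + move=> y /= /not_implyP[_ h]; rewrite in_itv/= => y01; apply: h.
    by rewrite y01.
Qed.

Lemma integral_le01 (f g : R -> R) : measurable_fun setT g ->
  (forall y, (0 <= y <= 1 -> f y <= g y)%R) ->
  \int[P]_y (f y)%:E <= \int[P]_y (g y)%:E.
Proof.
move=> mg fg; rewrite -(integral_off01 +oo mg); apply: integral_le_nonmeasurable => y.
by case: ifPn => [/fg|_]; rewrite ?leey// lee_fin.
Qed.

Lemma integral_ge01 (f g : R -> R) : measurable_fun setT g ->
  (forall y, (0 <= y <= 1 -> g y <= f y)%R) ->
  \int[P]_y (g y)%:E <= \int[P]_y (f y)%:E.
Proof.
move=> mg fg; rewrite -(integral_off01 -oo mg); apply: integral_le_nonmeasurable => y.
by case: ifPn => [/fg|_]; rewrite ?leNye// lee_fin.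
Qed.

Lemma integral_probability_cst (v : R) : \int[P]_y v%:E = v%:E.
Proof. by rewrite integral_cst//= probability_setT mule1. Qed.

Lemma integrable_id01 : P.-integrable setT (fun y => y%:E).
Proof.
apply/integrableP; split; first exact/measurable_EFinP.
have -> : \int[P]_y `|y%:E| = \int[P]_y (`|y|%R)%:E by [].
apply: (@le_lt_trans _ _ (\int[P]_y 1%:E)); last by rewrite integral_probability_cst ltry.
by apply: integral_le01 => // y /andP[y0 y1]; rewrite ger0_norm.
Qed.

Lemma integral_affine (v B : R) :
  \int[P]_y (v + B * (y - Rintegral P setT (fun y => y)))%:E = v%:E.
Proof.
set m := Rintegral _ _ _.
have iB : P.-integrable setT (fun y : R => B%:E * y%:E).
  exact: integrableZl integrable_id01.
have mE : \int[P]_y y%:E = m%:E.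
  by rewrite /m /Rintegral fineK//; exact: integrable_fin_num integrable_id01.
under eq_integral => y _.
  have -> : (v + B * (y - m) = (v - B * m) + B * y)%R by ring.
  rewrite EFinD EFinM; over.
rewrite integralD//; last by apply/integrableP; split => //; rewrite integral_probability_cst ltry.
rewrite integral_probability_cst integralZl//; last exact: integrable_id01.
by rewrite mE -EFinM -EFinD; congr EFin; ring.
Qed.

Lemma measurable_affine (v B m : R) :
  measurable_fun [set: R] (fun y : R => (v + B * (y - m))%R).
Proof.
by apply: measurable_funD => //; apply: measurable_funM => //; exact: measurable_funB.
Qed.

(** The bound [C] matters because [fine] sends infinite values to 0: the integral is first squeezed
    between two finite numbers. *)
Lemma Rintegral_ge_affine (f : R -> R) (v B C : R) :
  (forall y, (0 <= y <= 1 -> v + B * (y - Rintegral P setT (fun y => y)) <= f y <= C)%R) ->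
  (v <= Rintegral P setT f <= C)%R.
Proof.
move=> hf.
have lo : v%:E <= \int[P]_y (f y)%:E.
  rewrite -[leLHS](integral_affine v B); apply: integral_ge01.
    exact: measurable_affine.
  by move=> y /hf/andP[].
have hi : \int[P]_y (f y)%:E <= C%:E.
  rewrite -[leRHS]integral_probability_cst; apply: integral_le01 => // y.
  by move=> /hf/andP[].
rewrite /Rintegral; move: lo hi; case: (\int[P]_y _) => //= r.
by rewrite !lee_fin => -> ->.
Qed.

Lemma Rintegral_ge_cst (f : R -> R) (v C : R) :
  (forall y, (0 <= y <= 1 -> v <= f y <= C)%R) -> (v <= Rintegral P setT f <= C)%R.
Proof.
by move=> hf; apply: (@Rintegral_ge_affine f v 0) => y y01; rewrite mul0r addr0 hf.
Qed.

End AffineIntegralBounds.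

(** * Histories, and the sampling probabilities of KL-MS *)

Section Histories.
Variables (R : realType) (K : nat).
Implicit Types (h : history R K) (a b : 'I_K) (x y z : R).

Definition arm_total h a : R := \sum_(p <- h | p.1 == a) p.2.

Definition rewards01 h := all (fun p : 'I_K * R => 0 <= p.2 <= 1) h.

(* What the initial round-robin phase guarantees about reachable histories. *)
Definition reachable h :=
  rewards01 h /\ forall a, (0 < Ncount h a)%N = (a < size h)%N.

Lemma Ncount_rcons h b y a : Ncount (rcons h (b, y)) a = (Ncount h a + (b == a))%N.
Proof. by rewrite /Ncount -cats1 count_cat/= addn0. Qed.

Lemma arm_total_rcons h b y a :
  arm_total (rcons h (b, y)) a = arm_total h a + (if b == a then y else 0).
Proof. by rewrite /arm_total -cats1 big_cat/= big_cons big_nil/=; case: ifP => _; rewrite ?addr0. Qed.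

Lemma arm_total_ge0 h a : rewards01 h -> 0 <= arm_total h a.
Proof.
move=> /allP h01; rewrite /arm_total big_seq_cond; apply: sumr_ge0 => p /andP[ph _].
by have /andP[] := h01 p ph.
Qed.

Lemma arm_total_le h a : rewards01 h -> arm_total h a <= (Ncount h a)%:R.
Proof.
rewrite /arm_total /Ncount; elim: h => [|p h IH]; first by rewrite big_nil.
rewrite /= big_cons => /andP[/andP[_ p1] /IH]; rewrite natrD.
by case: ifP => _ /=; lra.
Qed.

Lemma Ncount_le_size h a : (Ncount h a <= size h)%N.
Proof. exact: count_size. Qed.

Lemma muhatE h a : muhat h a = arm_total h a / (Ncount h a)%:R.
Proof. by []. Qed.

Lemma muhat01 h a : rewards01 h -> 0 <= muhat h a <= 1.
Proof.
move=> h01; have t0 := arm_total_ge0 a h01; have t1 := arm_total_le a h01.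
rewrite muhatE divr_ge0//=; case: (posnP (Ncount h a)) => [->|N0].
  by rewrite invr0 mulr0.
by rewrite ler_pdivrMr ?mul1r// ltr0n.
Qed.

Lemma muhat_le_max h a b : muhat h b <= muhat_max h a.
Proof. exact: le_bigmax. Qed.

Lemma muhat_max_attained h a : exists b, muhat_max h a = muhat h b.
Proof.
rewrite /muhat_max; elim/big_ind: _ => [|x y [b ->] [c ->]|b _]; first by exists a.
- by case: (leP (muhat h b) (muhat h c)) => _; [exists c | exists b].
- by exists b.
Qed.

Lemma muhat_max_le h a b : muhat_max h a <= muhat_max h b.
Proof. by have [c ->] := muhat_max_attained h a; exact: muhat_le_max. Qed.

Lemma muhat_max_seed h a b : muhat_max h a = muhat_max h b.
Proof. by apply/le_anti; rewrite !muhat_max_le. Qed.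

Lemma klms_weight_max h a : muhat h a = muhat_max h a -> klms_weight h a = 1.
Proof. by move=> e; rewrite /klms_weight -e /kl eqxx /= mulr0 oppr0 expR0. Qed.

Lemma klms_weight_in01 h a : 0 < muhat_max h a < 1 ->
  klms_weight h a = expR (- ((Ncount h a)%:R * KL (muhat h a) (muhat_max h a))).
Proof. by move=> M01; rewrite /klms_weight klE. Qed.

Lemma klms_weight_ge1 h a : muhat h a != muhat_max h a -> 1 <= muhat_max h a ->
  klms_weight h a = 0.
Proof. by move=> ne M1; rewrite /klms_weight /kl (negbTE ne) M1 orbT. Qed.

Lemma klms_weight_ge0 h a : 0 <= klms_weight h a.
Proof. by rewrite /klms_weight; case: (kl _ _) => // r; exact: expR_ge0. Qed.

Lemma muhat_max_gt0 h a : rewards01 h -> muhat h a != muhat_max h a -> 0 < muhat_max h a.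
Proof.
move=> h01 ne; have /andP[m0 _] := muhat01 a h01.
by apply: le_lt_trans m0 _; rewrite lt_neqAle ne muhat_le_max.
Qed.

Lemma klms_weight_le1 h a : rewards01 h -> klms_weight h a <= 1.
Proof.
move=> h01; have [/klms_weight_max->//|ne] := eqVneq (muhat h a) (muhat_max h a).
have M0 := muhat_max_gt0 h01 ne.
have [M1|M1] := leP 1 (muhat_max h a); first by rewrite klms_weight_ge1.
have M01 : 0 < muhat_max h a < 1 by rewrite M0.
rewrite klms_weight_in01// -expR0 ler_expR oppr_le0 mulr_ge0//.
exact: KL_ge0 (muhat01 _ h01) M01.
Qed.

Lemma klms_weight_upper h a z x : rewards01 h -> muhat h a <= z -> 0 < z -> z < x ->
  x <= muhat_max h a -> klms_weight h a <= expR (- ((Ncount h a)%:R * KL z x)).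
Proof.
move=> h01 pz z0 zx xM.
have ne : muhat h a != muhat_max h a by rewrite lt_eqF//; lra.
have [M1|M1] := leP 1 (muhat_max h a); first by rewrite klms_weight_ge1// expR_ge0.
have M01 : 0 < muhat_max h a < 1 by rewrite (muhat_max_gt0 h01 ne).
rewrite klms_weight_in01// ler_expR lerN2 ler_wpM2l//.
have /andP[p0 _] := muhat01 a h01.
exact: KL_mono p0 pz z0 (ltW zx) xM M1.
Qed.

(** Raising the reference from the maximum to [x] can only increase the divergence, by the
    Pythagorean inequality. *)
Lemma klms_weight_lower h a x : rewards01 h -> muhat_max h a < x -> x < 1 ->
  expR (- ((Ncount h a)%:R * KL (muhat h a) x)) <= klms_weight h a.
Proof.
move=> h01 Mx x1; have /andP[p0 p1] := muhat01 a h01.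
have pM := muhat_le_max h a a.
have p01 : 0 <= muhat h a <= 1 by rewrite p0.
have x01 : 0 < x < 1 by apply/andP; split; lra.
have [/klms_weight_max->|ne] := eqVneq (muhat h a) (muhat_max h a).
  by rewrite -expR0 ler_expR oppr_le0 mulr_ge0//; exact: KL_ge0.
have M0 := muhat_max_gt0 h01 ne.
have M01 : 0 < muhat_max h a < 1 by apply/andP; split; lra.
rewrite klms_weight_in01// ler_expR lerN2 ler_wpM2l//.
apply: le_trans (KL_pyth p0 pM M0 (ltW Mx) x1); rewrite lerDl.
exact: KL_ge0 (andb_true_intro (conj (ltW M0) (ltW (lt_trans Mx x1)))) x01.
Qed.

Hypothesis K0 : (0 < K)%N.

Lemma klms_weight_sum_ge1 h : 1 <= \sum_(b < K) klms_weight h b.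
Proof.
have [b hb] := muhat_max_attained h (Ordinal K0).
rewrite (bigD1 b)//= klms_weight_max; last by rewrite -hb; exact: muhat_max_seed.
by rewrite lerDl; apply: sumr_ge0 => c _; exact: klms_weight_ge0.
Qed.

Lemma klms_prob_ge0 h a : 0 <= klms_prob h a.
Proof.
rewrite /klms_prob; case: ifP => _; first by case: ifP.
by rewrite divr_ge0 ?klms_weight_ge0// (le_trans ler01 (klms_weight_sum_ge1 h)).
Qed.

Lemma klms_prob_sum h : \sum_(a < K) klms_prob h a = 1.
Proof.
rewrite /klms_prob; case: (ltnP (size h) K) => [hK|_].
  rewrite (bigD1 (Ordinal hK))//= eqxx big1 ?addr0// => i ne.
  by case: ifPn => // /eqP e; case/eqP: ne; exact: val_inj.
rewrite -mulr_suml divff// gt_eqF//.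
exact: lt_le_trans ltr01 (klms_weight_sum_ge1 h).
Qed.

Lemma klms_prob_meanE h x : x = \sum_(a < K) klms_prob h a * x.
Proof. by rewrite -mulr_suml klms_prob_sum mul1r. Qed.

Lemma reachable_nil : reachable [::].
Proof. by []. Qed.

Lemma reachable_rcons h b y : reachable h -> 0 <= y <= 1 -> 0 < klms_prob h b ->
  reachable (rcons h (b, y)).
Proof.
move=> [h01 hN] y01 pb; split; first by rewrite /rewards01 all_rcons/= y01.
move=> a; rewrite Ncount_rcons size_rcons addn_gt0 hN lt0b.
move: pb; rewrite /klms_prob; case: ltnP => [hK|hK _].
  case: ifP => [/eqP bh _|_]; last by rewrite ltxx.
  by rewrite ltnS [RHS]leq_eqVlt orbC -bh -val_eqE [val b == _]eq_sym.
by rewrite (leq_trans (ltn_ord a) hK) (leq_trans (ltn_ord a) (leqW hK)).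
Qed.

(** The terms cover, in order: few pulls of [a], an overestimated [a], an underestimated arm [i],
    and the typical case. *)
Lemma klms_prob_le h a i (u : R) z x : reachable h -> 0 < z -> z < x -> x < 1 -> 0 < u ->
  klms_prob h a <=
    klms_prob h a * (((Ncount h a)%:R < u)%R%:R +
      ((0 < Ncount h a)%N && ((Ncount h a)%:R * z < arm_total h a))%:R)
    + klms_prob h i * (if (0 < Ncount h i)%N && (arm_total h i < (Ncount h i)%:R * x)
       then expR ((Ncount h i)%:R * KL (arm_total h i / (Ncount h i)%:R) x) else 0)
    + expR (- (u * KL z x)).
Proof.
move=> [h01 hN] z0 zx x1 u0.
have pa := klms_prob_ge0 h a; have pi0 := klms_prob_ge0 h i.
set W := if _ then _ else _.
have W0 : 0 <= W by rewrite /W; case: ifP => _ //; exact: expR_ge0.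
have e0 := expR_ge0 (- (u * KL z x)).
have pW : 0 <= klms_prob h i * W by exact: mulr_ge0.
set V := nat_of_bool (_ && _).
have [Nu|Nu] := ltP (Ncount h a)%:R u.
  have : 0 <= klms_prob h a * V%:R by rewrite mulr_ge0.
  by rewrite mulrDr mulr1; lra.
rewrite add0r.
have N0 : (0 < Ncount h a)%N by rewrite -(ltr0n R); exact: lt_le_trans Nu.
rewrite /V N0/=; have [zt|tz] := ltP ((Ncount h a)%:R * z) (arm_total h a).
  by rewrite mulr1; lra.
rewrite mulr0 add0r.
have N0' : 0 < (Ncount h a)%:R :> R by rewrite ltr0n.
have pz : muhat h a <= z by rewrite muhatE ler_pdivrMr// mulrC.
(* In the round-robin phase the arm to be pulled has not been pulled yet, against [N0]. *)
have [hK|hK] := ltnP (size h) K.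
  rewrite {1}/klms_prob hK; case: ifPn => [/eqP ah|_]; last exact: addr_ge0.
  by move: N0; rewrite hN ah ltnn.
have Sge1 := klms_weight_sum_ge1 h.
have S0 : 0 < \sum_(b < K) klms_weight h b by exact: lt_le_trans ltr01 Sge1.
have pE b : klms_prob h b = klms_weight h b / \sum_(b < K) klms_weight h b.
  by rewrite /klms_prob ltnNge hK.
have [xM|Mx] := leP x (muhat_max h a).
  apply: ler_wpDl => //; rewrite pE ler_pdivrMr//.
  apply: (@le_trans _ _ (expR (- (u * KL z x)))); last by rewrite ler_peMr.
  apply: le_trans (klms_weight_upper h01 pz z0 zx xM) _.
  rewrite ler_expR lerN2 ler_wpM2r//.
  by apply: KL_ge0; apply/andP; split; lra.
apply: ler_wpDr => //.
have Ni0 : (0 < Ncount h i)%N by rewrite hN (leq_trans (ltn_ord i) hK).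
have Ni0' : 0 < (Ncount h i)%:R :> R by rewrite ltr0n.
have iM : muhat h i < x by exact: le_lt_trans (muhat_le_max h a i) Mx.
have -> : W = expR ((Ncount h i)%:R * KL (muhat h i) x).
  by rewrite /W Ni0/= ifT// mulrC -ltr_pdivrMr.
rewrite !pE mulrAC ler_wpM2r ?invr_ge0 ?(ltW S0)//.
(* The denominators being equal, it suffices that the weight of [a] is at most 1, itself at most [W]
   times the weight of [i]. *)
apply: (le_trans (klms_weight_le1 a h01)).
rewrite (muhat_max_seed h a i) in Mx.
have := klms_weight_lower h01 Mx x1.
by rewrite expRN -[_^-1]mul1r ler_pdivrMr ?expR_gt0.
Qed.

End Histories.

(** * From one-step potential inequalities to the regret *)

Section Regret.
Variables (R : realType) (K : nat) (nu : 'I_K -> probability R R).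
Hypothesis K0 : (0 < K)%N.
Hypothesis nu01 : forall a, nu a `[0%R, 1%R]%classic = 1%E.
Implicit Types (h : history R K) (a b : 'I_K).

Let reward h : R := \sum_(p <- h) p.2.

Lemma reward_rcons h b y : reward (rcons h (b, y)) = reward h + y.
Proof. by rewrite /reward -cats1 big_cat big_cons big_nil/= addr0. Qed.

Lemma mean01 a : 0 <= mean nu a <= 1.
Proof. exact: Rintegral_ge_cst. Qed.

Lemma klms_expect_reward01 n h : rewards01 h ->
  0 <= klms_expect nu n h reward <= (size h + n)%:R.
Proof.
elim: n h => [|n IH] h h01 /=.
  rewrite addn0 /reward; elim: h h01 => [|p h IH]; first by rewrite big_nil lexx.
  rewrite /= big_cons -natr1 => /andP[/andP[p0 p1] /IH/andP[s0 s1]].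
  by apply/andP; split; lra.
have hb b : 0 <= Rintegral (nu b) setT
    (fun y => klms_expect nu n (rcons h (b, y)) reward) <= (size h + n.+1)%:R.
  apply: Rintegral_ge_cst => // y y01.
  have := IH (rcons h (b, y)); rewrite size_rcons addSnnS; apply.
  by rewrite /rewards01 all_rcons/= y01.
apply/andP; split.
  apply: sumr_ge0 => b _; rewrite mulr_ge0 ?klms_prob_ge0//.
  by have /andP[] := hb b.
rewrite (klms_prob_meanE K0 h (size h + n.+1)%:R); apply: ler_sum => b _; rewrite ler_wpM2l ?klms_prob_ge0//.
by have /andP[] := hb b.
Qed.

Variables (m1 : R) (T : nat).

(* [Psi n h] plays the role of a supermartingale bounding the regret of the
   [n] rounds that follow the history [h]. *)
Lemma klms_expect_reward_ge (Psi : nat -> history R K -> R) :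
  (forall h, 0 <= Psi 0%N h) ->
  (forall n h, reachable h -> (size h + n < T)%N ->
     exists2 psi : 'I_K -> R,
       forall b, 0 < klms_prob h b ->
         maj (mean nu b) (fun y => Psi n (rcons h (b, y))) (psi b) &
       \sum_(b < K) klms_prob h b * (m1 - mean nu b + psi b) <= Psi n.+1 h) ->
  forall n h, reachable h -> (size h + n <= T)%N ->
  reward h + n%:R * m1 - Psi n h <= klms_expect nu n h reward.
Proof.
move=> Psi0 Psi_step; elim=> [|n IH] h rh hT /=.
  by rewrite mul0r addr0 gerBl.
have [psi hpsi psi_le] := Psi_step n h rh ltac:(by rewrite -addnS).
apply: (@le_trans _ _ (\sum_(b < K) klms_prob h b *
    (reward h + n%:R * m1 + mean nu b - psi b))).
  have -> : \sum_(b < K) klms_prob h b * (reward h + n%:R * m1 + mean nu b - psi b) =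
     reward h + n.+1%:R * m1 - \sum_(b < K) klms_prob h b * (m1 - mean nu b + psi b).
    rewrite (klms_prob_meanE K0 h (reward h + n.+1%:R * m1)) -sumrB.
    by apply: eq_bigr => b _; rewrite -natr1; ring.
  by rewrite lerD2l lerN2.
apply: ler_sum => b _.
have := klms_prob_ge0 K0 h b; rewrite le_eqVlt => /predU1P[<-|pb].
  by rewrite !mul0r.
rewrite ler_pM2l//.
have [B hB] := hpsi b pb.
suff /andP[] : reward h + n%:R * m1 + mean nu b - psi b <=
  Rintegral (nu b) setT (fun y => klms_expect nu n (rcons h (b, y)) reward)
    <= (size h + n.+1)%:R by [].
(* The reward contributes slope 1, the majorant of [Psi] slope [B]. *)
apply: (@Rintegral_ge_affine _ _ (nu01 b) _ _ (1 - B)) => y y01.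
have rh' := reachable_rcons rh y01 pb.
have := IH _ rh'; rewrite size_rcons addSnnS => /(_ hT).
have [h01 _] := rh'.
have /andP[_] := klms_expect_reward01 n h01.
rewrite size_rcons addSnnS => -> hl; rewrite andbT; apply: le_trans hl.
rewrite reward_rcons -/(mean nu b).
by have := hB y y01; lra.
Qed.

(** A single potential pays for every pull of [a]: [U] for the first ones, [n * th] for the typical
    case, [V] and [W] for the deviations. [V] and [W] move only when their own arm is pulled. *)
Lemma pull_potential (a i : 'I_K) (z x u : R) (V W : nat -> R -> R) :
  0 < z -> z < x -> x < 1 -> 0 < u ->
  (forall k s, 0 <= V k s) -> (forall k s, 0 <= W k s) ->
  (forall k s, (k < T)%N -> maj (mean nu a) (fun y => V k.+1 (s + y))
      (V k s - ((0 < k)%N && (k%:R * z < s))%:R)) ->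
  (forall k s, (k < T)%N -> 0 <= s -> maj (mean nu i) (fun y => W k.+1 (s + y))
      (W k s - (if (0 < k)%N && (s < k%:R * x)
                then expR (k%:R * KL (s / k%:R) x) else 0))) ->
  exists Phi : nat -> history R K -> R,
  [/\ forall n h, 0 <= Phi n h,
    Phi T [::] = u + 1 + T%:R * expR (- (u * KL z x)) + V 0%N 0 + W 0%N 0 &
    forall n h, reachable h -> (size h + n < T)%N ->
     exists2 phi : 'I_K -> R,
       forall b, maj (mean nu b) (fun y => Phi n (rcons h (b, y))) (phi b) &
       klms_prob h a + \sum_(b < K) klms_prob h b * phi b <= Phi n.+1 h].
Proof.
move=> z0 zx x1 u0 V0 W0 hV hW.
set th := expR (- (u * KL z x)).
(* The spare 1 keeps [U] positive after a pull made with count below [u], so that such a pull lowers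
   it by exactly 1. *)
pose U (k : nat) : R := Num.max (u + 1 - k%:R) 0.
exists (fun n h => U (Ncount h a) + n%:R * th + V (Ncount h a) (arm_total h a)
    + W (Ncount h i) (arm_total h i)); split.
- move=> n h; rewrite !addr_ge0//; first by rewrite /U le_max lexx orbT.
  by rewrite mulr_ge0// expR_ge0.
- by rewrite /U /Ncount /arm_total !big_nil/= subr0 max_l//; lra.
move=> n h rh hT; have [h01 _] := rh.
pose gU : R := ((Ncount h a)%:R < u)%R%:R.
pose gV : R := ((0 < Ncount h a)%N && ((Ncount h a)%:R * z < arm_total h a))%:R.
pose gW := if (0 < Ncount h i)%N && (arm_total h i < (Ncount h i)%:R * x)
   then expR ((Ncount h i)%:R * KL (arm_total h i / (Ncount h i)%:R) x) else 0.
have NT b : (Ncount h b < T)%N.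
  by apply: leq_ltn_trans (Ncount_le_size h b) (leq_ltn_trans (leq_addr _ _) hT).
exists (fun b => U (Ncount h a) - (if b == a then gU else 0) + n%:R * th
   + (V (Ncount h a) (arm_total h a) - (if b == a then gV else 0))
   + (W (Ncount h i) (arm_total h i) - (if b == i then gW else 0))).
  move=> b; apply: majD; [apply: majD; [apply: majD|]|].
  - apply: maj_le (maj_cst _ _) _ (lexx _) => y _.
    rewrite Ncount_rcons; case: eqP => _; last by rewrite addn0 subr0.
    rewrite addn1 /U /gU -natr1; case: (ltP (Ncount h a)%:R u) => Nu /=.
      have -> : Num.max (u + 1 - (Ncount h a)%:R) 0 = u + 1 - (Ncount h a)%:R.
        by rewrite max_l//; lra.
      by rewrite max_l//; lra.
    rewrite subr0 (@max_r _ _ (u + 1 - ((Ncount h a)%:R + 1)) 0); last by lra.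
    by rewrite le_max lexx orbT.
  - exact: maj_cst.
  - case: (eqVneq b a) => [->|ba].
      apply: maj_le (hV _ (arm_total h a) (NT a)) _ (lexx _) => y _.
      by rewrite Ncount_rcons arm_total_rcons eqxx addn1.
    apply: maj_le (maj_cst _ _) _ (lexx _) => y _.
    by rewrite Ncount_rcons arm_total_rcons (negbTE ba) addn0 addr0 subr0.
  - case: (eqVneq b i) => [->|bi].
      apply: maj_le (hW _ (arm_total h i) (NT i) (arm_total_ge0 i h01)) _ (lexx _) => y _.
      by rewrite Ncount_rcons arm_total_rcons eqxx addn1.
    apply: maj_le (maj_cst _ _) _ (lexx _) => y _.
    by rewrite Ncount_rcons arm_total_rcons (negbTE bi) addn0 addr0 subr0.
have key := klms_prob_le K0 a i rh z0 zx x1 u0.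
rewrite -/th -/gU -/gV -/gW in key.
set A := U (Ncount h a); set v := V _ _; set w := W _ _.
have -> : \sum_(b < K) klms_prob h b * (A - (if b == a then gU else 0) + n%:R * th
   + (v - (if b == a then gV else 0)) + (w - (if b == i then gW else 0))) =
   A + n%:R * th + v + w - klms_prob h a * (gU + gV) - klms_prob h i * gW.
  have sum1 c (g : R) : klms_prob h c * g = \sum_(b < K) klms_prob h b * (if b == c then g else 0).
    rewrite (bigD1 c)//= eqxx big1 ?addr0// => b bc.
    by rewrite (negbTE bc) mulr0.
  rewrite (sum1 a) (sum1 i) (klms_prob_meanE K0 h (A + n%:R * th + v + w)) -!sumrB.
  by apply: eq_bigr => b _; case: (b == a); case: (b == i); ring.
by rewrite -[n.+1%:R]natr1; lra.
Qed.

End Regret.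

(** * Explicit constants for one arm, and the sum over arms *)

Lemma pull_potential_bound (R : realType) (K : nat) (nu : 'I_K -> probability R R)
  (a i : 'I_K) (c : R) (T : nat) :
  (0 < K)%N -> (forall b, nu b `[0%R, 1%R]%classic = 1%E) -> 0 < c -> c <= 1 / 4 ->
  let gap := mean nu i - mean nu a in
  let v := mean nu i * (1 - mean nu i) in
  let klc := fine (kl (mean nu a + c * gap) (mean nu i - c * gap)) in
  0 < gap ->
  exists Phi : nat -> history R K -> R,
  [/\ forall n h, 0 <= Phi n h,
    Phi T [::] <= ln (Num.max (T%:R * klc) (expR 2)) / klc
      + 455 * ((v + gap) / (c ^+ 2 * gap ^+ 2)) &
    forall n h, reachable h -> (size h + n < T)%N ->
     exists2 phi : 'I_K -> R,
       forall b, maj (mean nu b) (fun y => Phi n (rcons h (b, y))) (phi b) &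
       klms_prob h a + \sum_(b < K) klms_prob h b * phi b <= Phi n.+1 h].
Proof.
move=> K0 nu01 c0 c1 gap v klc gap0.
have /andP[a0 a1] := mean01 nu01 a; have /andP[i0 i1] := mean01 nu01 i.
set mi := mean nu i in i0 i1 gap v klc gap0 *.
set ma := mean nu a in a0 a1 gap v klc gap0 *.
have gapE : gap = mi - ma by [].
pose e := c * gap.
have e0 : 0 < e by rewrite mulr_gt0.
have e4 : e <= gap / 4 by rewrite /e; nra.
pose x := mi - e; pose z := ma + e.
have z0 : 0 < z by rewrite /z; lra.
have zx : z < x by rewrite /z /x; lra.
have x1 : x < 1 by rewrite /x; lra.
have x01 : 0 < x < 1 by apply/andP; split; lra.
have klcE : klc = KL z x by rewrite /klc klE.
pose w := v + gap.
have v0 : 0 <= v by rewrite mulr_ge0//; lra.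
have w0 : 0 < w by rewrite /w; lra.
(* Since [c <= 1 / 4], [z] and [x] stay at least [gap / 2] apart. *)
have kl_ge : gap ^+ 2 / (16 * w) <= klc.
  rewrite klcE; apply: le_trans (KL_ge_quad (ltW z0) (ltW zx) x01).
  have d1 : gap / 2 <= x - z by rewrite /x /z; lra.
  have d2 : x * (1 - x) + (x - z) <= w by rewrite /w /v /x /z; nra.
  have d3 : 0 < x * (1 - x) + (x - z) by rewrite ltr_wpDl ?subr_gt0// mulr_ge0; lra.
  rewrite ler_pdivrMr; last lra.
  rewrite mulrAC ler_pdivlMr; last lra.
  have d4 : (gap / 2) ^+ 2 <= (x - z) ^+ 2 by rewrite ler_sqr ?nnegrE//; lra.
  have := sqr_ge0 gap; move: d4; rewrite expr_div_n; nra.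
have kl0 : 0 < klc.
  by apply: lt_le_trans kl_ge; rewrite divr_gt0 ?exprn_gt0//; lra.
have kl_inv : klc^-1 <= 16 * w / gap ^+ 2.
  rewrite -[leRHS]invf_div lef_pV2 ?posrE// divr_gt0 ?exprn_gt0//; lra.
set M := Num.max _ _.
have M2 : expR 2 <= M by rewrite /M le_max lexx orbT.
have M0 : 0 < M by exact: lt_le_trans (expR_gt0 _) M2.
have lnM : 2 <= ln M by rewrite -(expRK (2 : R)) ler_ln ?posrE ?expR_gt0.
pose u := ln M / klc.
have u0 : 0 < u by rewrite divr_gt0//; lra.
have [V [V0 V00 hV]] := upper_deviation_potential T (mean01 nu01 a) e0.
have emi : e < mi by lra.
have hw : mi * (1 - mi) + e <= w by rewrite /w -/v; lra.
have [W [W0 W00 hW]] := lower_deviation_potential T i1 e0 emi hw.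
have [Phi [Phi0 PhiT Phi_step]] := pull_potential K0 z0 zx x1 u0 V0 W0 hV hW.
exists Phi; split => //; rewrite PhiT -/u.
have e2 : expR (- (u * KL z x)) = M^-1.
  by rewrite -klcE /u divfK ?gt_eqF// expRN lnK.
have TM : T%:R * M^-1 <= klc^-1.
  rewrite ler_pdivrMr// mulrC ler_pdivlMr//.
  by rewrite /M le_max lexx.
have H0 : 0 < gap ^+ 2 by rewrite exprn_gt0.
pose H := w / (c ^+ 2 * gap ^+ 2).
rewrite -/w -/H.
have c20 : 0 < c ^+ 2 by rewrite exprn_gt0.
have c2 : c ^+ 2 <= 1 / 16 by nra.
have eE : e ^+ 2 = c ^+ 2 * gap ^+ 2 by rewrite /e exprMn.
have wE : w = H * e ^+ 2.
  by rewrite /H eE divfK// gt_eqF// mulr_gt0.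
have Hge0 : 0 < H by rewrite divr_gt0// mulr_gt0.
have b1 : 1 <= H.
  rewrite /H ler_pdivlMr ?mulr_gt0// mul1r.
  apply: (@le_trans _ _ gap); last by rewrite /w lerDr.
  have : gap <= 1 by lra.
  nra.
have b2 : 16 * w / gap ^+ 2 <= H.
  have -> : 16 * w / gap ^+ 2 = 16 * c ^+ 2 * H.
    by rewrite /H; field; rewrite !gt_eqF.
  by rewrite ler_piMl ?(ltW Hge0)//; lra.
(* [ma * (1 - ma)] is at most [w] and [e] at most [w / 4], so the factor 4 becomes 5. *)
have b3 : V 0%N 0 <= 5 * H.
  apply: le_trans V00 _; rewrite -/ma ler_pdivrMr ?exprn_gt0// -mulrA -wE.
  have : ma * (1 - ma) <= v + gap by rewrite /v gapE; nra.
  by rewrite /w; lra.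
have b4 : W 0%N 0 <= 448 * H.
  apply: le_trans W00 _; rewrite ler_pdivrMr ?exprn_gt0// -mulrA -wE//.
(* The constant 1, the typical case, [V] and [W] give the coefficient 1 + 1 + 5 + 448 = 455 of
   [H]. *)
rewrite e2; move: TM kl_inv; lra.
Qed.

Theorem theorem1 (R : realType) (K : nat) (hK : (2 <= K)%N)
  (nu : 'I_K -> probability R R)
  (hsupp : forall a, nu a `[0%R, 1%R]%classic = 1%E)
  (a1 : 'I_K) (ha1 : nat_of_ord a1 = 0%N)
  (hord : forall a b : 'I_K, (a <= b)%N -> mean nu b <= mean nu a)
  (T : nat) (Delta c : R) (hDelta : 0 <= Delta) (hc0 : 0 < c) (hc1 : c <= 1/4) :
  let mu := mean nu in
  let gap := fun a => mu a1 - mu a in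
  let mudot1 := mu a1 * (1 - mu a1) in
  let klc := fun a => fine (kl (mu a + c * gap a) (mu a1 - c * gap a)) in
  klms_regret nu a1 T <=
    T%:R * Delta
    + \sum_(a < K | gap a > Delta)
        gap a * ln (Num.max (T%:R * klc a) (expR 2)) / klc a
    + 392 * \sum_(a < K | gap a > Delta)
        ((mudot1 + gap a) / (c ^+ 2 * gap a)) *
        ln (Num.max (Num.min ((mudot1 + gap a) / (c ^+ 2 * gap a ^+ 2))
                             (c ^+ 2 * T%:R * gap a ^+ 2 / (mudot1 + gap a)))
                    (expR 2)).
Proof.
pose mu := mean nu; pose gap a := mu a1 - mu a.
pose mudot1 := mu a1 * (1 - mu a1).
pose klc a := fine (kl (mu a + c * gap a) (mu a1 - c * gap a)).
change (klms_regret nu a1 T <=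
    T%:R * Delta
    + \sum_(a < K | gap a > Delta) gap a * ln (Num.max (T%:R * klc a) (expR 2)) / klc a
    + 392 * \sum_(a < K | gap a > Delta)
        ((mudot1 + gap a) / (c ^+ 2 * gap a)) *
        ln (Num.max (Num.min ((mudot1 + gap a) / (c ^+ 2 * gap a ^+ 2))
                             (c ^+ 2 * T%:R * gap a ^+ 2 / (mudot1 + gap a)))
                    (expR 2))).
have K0 : (0 < K)%N by exact: leq_trans hK.
pose H a := (mudot1 + gap a) / (c ^+ 2 * gap a ^+ 2).
have /choice[Phi hPhi] : forall a, exists Phi : nat -> history R K -> R, Delta < gap a ->
  [/\ forall n h, 0 <= Phi n h,
    Phi T [::] <= ln (Num.max (T%:R * klc a) (expR 2)) / klc a + 455 * H a &
    forall n h, reachable h -> (size h + n < T)%N ->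
     exists2 phi : 'I_K -> R,
       forall b, maj (mu b) (fun y => Phi n (rcons h (b, y))) (phi b) &
       klms_prob h a + \sum_(b < K) klms_prob h b * phi b <= Phi n.+1 h].
  move=> a; have [ga|_] := ltP Delta (gap a); last by exists (fun _ _ => 0).
  have [Phi hPhi] := @pull_potential_bound R K nu a a1 c T K0 hsupp hc0 hc1 (le_lt_trans hDelta ga).
  by exists Phi.
have gap_ge0 a : Delta < gap a -> 0 <= gap a by move=> /ltW; exact: le_trans.
(* Pulls of arms of gap at most [Delta] are paid by [n * Delta], the others by the potential of the
   arm pulled. *)
pose Psi n h := n%:R * Delta + \sum_(a < K | Delta < gap a) gap a * Phi a n h.
have Psi0 h : 0 <= Psi 0%N h.
  rewrite /Psi mul0r add0r; apply: sumr_ge0 => a ga.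
  by have [P0 _ _] := hPhi a ga; rewrite mulr_ge0 ?gap_ge0.
have Psi_step n h : reachable h -> (size h + n < T)%N ->
     exists2 psi : 'I_K -> R,
       forall b, 0 < klms_prob h b ->
         maj (mean nu b) (fun y => Psi n (rcons h (b, y))) (psi b) &
       \sum_(b < K) klms_prob h b * (mu a1 - mean nu b + psi b) <= Psi n.+1 h.
  move=> rh hT.
  have /choice[phi hphi] : forall a, exists phi : 'I_K -> R, Delta < gap a ->
      (forall b, maj (mu b) (fun y => Phi a n (rcons h (b, y))) (phi b)) /\
       klms_prob h a + \sum_(b < K) klms_prob h b * phi b <= Phi a n.+1 h.
    move=> a; have [ga|_] := ltP Delta (gap a); last by exists (fun=> 0).
    have [_ _ st] := hPhi a ga; have [phi h1 h2] := st n h rh hT.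
    by exists phi.
  exists (fun b => n%:R * Delta + \sum_(a < K | Delta < gap a) gap a * phi a b).
    move=> b _; apply: majD; first exact: maj_cst.
    apply: maj_sum => a _ ga; apply: majZ; first exact: gap_ge0.
    by have [+ _] := hphi a ga; apply.
  apply: (@le_trans _ _ (\sum_(b < K) klms_prob h b * (n.+1%:R * Delta) +
    \sum_(a < K | Delta < gap a) gap a *
      (klms_prob h a + \sum_(b < K) klms_prob h b * phi a b))); last first.
    rewrite -klms_prob_meanE// lerD2l; apply: ler_sum => a ga.
    by have [_ ?] := hphi a ga; rewrite ler_wpM2l ?gap_ge0.
  have -> : \sum_(a < K | Delta < gap a) gap a *
      (klms_prob h a + \sum_(b < K) klms_prob h b * phi a b) =
    \sum_(a < K | Delta < gap a) gap a * klms_prob h a +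
    \sum_(b < K) klms_prob h b * \sum_(a < K | Delta < gap a) gap a * phi a b.
    under eq_bigr do rewrite mulrDr mulr_sumr.
    rewrite big_split/= [X in _ + X = _]exchange_big/=; congr (_ + _).
    apply: eq_bigr => b _; rewrite mulr_sumr.
    by apply: eq_bigr => a _; ring.
  rewrite addrA.
  rewrite [X in _ + X + _]big_mkcond/= -!big_split/=; apply: ler_sum => b _.
  rewrite -/(mu b) -/(gap b) -natr1; set sg := \sum_(_ < _ | _) _.
  have p0 := klms_prob_ge0 K0 h b.
  case: ltP => gb; first by have := mulr_ge0 p0 hDelta; lra.
  by have := ler_wpM2l p0 gb; lra.
have := klms_expect_reward_ge K0 hsupp Psi0 Psi_step (reachable_nil R K) (leqnn T).
rewrite big_nil add0r /klms_regret -/(mu a1) => lower.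
apply: (@le_trans _ _ (Psi T [::])); first by lra.
rewrite /Psi -addrA; apply: lerD => //; rewrite mulr_sumr -big_split/=; apply: ler_sum => a ga.
have [_ hT _] := hPhi a ga.
have g0 : 0 < gap a by exact: le_lt_trans ga.
apply: le_trans (ler_wpM2l (ltW g0) hT) _.
rewrite mulrDr; apply: lerD; first by rewrite mulrA.
have Hg : (mudot1 + gap a) / (c ^+ 2 * gap a) = gap a * H a.
  by rewrite /H; field; rewrite !gt_eqF.
have H0 : 0 <= gap a * H a.
  rewrite -Hg divr_ge0//; last by rewrite mulr_ge0 ?sqr_ge0// ltW.
  have /andP[m0 m1] := mean01 hsupp a1.
  by rewrite addr_ge0 ?(ltW g0)// mulr_ge0 ?subr_ge0.
rewrite Hg.
set M := Num.max _ _.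
have M2 : expR 2 <= M by rewrite /M le_max lexx orbT.
(* With [ln M] at least 2, the factor [392 * ln M] is at least 784, which covers 455. *)
have lnM : 2 <= ln M.
  by rewrite -(expRK (2 : R)) ler_ln ?posrE ?expR_gt0// (lt_le_trans (expR_gt0 2)).
have := ler_wpM2l H0 lnM; lra.
Qed.
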